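(* Let $\lambda_0(A)$ be a $G_1$-space whose Köthe matrix $A=(a_n)_n$ satisfies $\lim_{i\to\infty}a_n(i)=0$ for all $n\in\mathbb{N}$. Then the Cesàro operator $\mathsf{C}:\lambda_0(A)\to\lambda_0(A)$ is power bounded and uniformly mean ergodic. In particular, $$\lambda_0(A)=\ker(I-\mathsf{C})\oplus\overline{(I-\mathsf{C})(\lambda_0(A))}.$$ Moreover, $\ker(I-\mathsf{C})=\operatorname{span}\{\boldsymbol{1}\}$, where $\boldsymbol 1=(1,1,1,\dots)$, and $$\overline{(I-\mathsf{C})(\lambda_0(A))}=\{x\in\lambda_0(A):x_1=0\}=\overline{\operatorname{span}\{e_i:i\ge2\}},$$ where $(e_i)_{i\in\mathbb{N}}$ are the canonical unit vectors.
   Context: $\mathbb{N}=\{1,2,3,\dots\}$. A Köthe matrix is $A=(a_n)_{n\in\mathbb{N}}$, $a_n=(a_n(i))_{i\in\mathbb{N}}$, with $0\le a_n(i)\le a_{n+1}(i)$ for all $i,n$, and such that for every $i$ there is $n$ with $a_n(i)>0$. The Köthe echelon space of order $0$ is $\lambda_0(A)=\{x\in\mathbb{C}^{\mathbb{N}}:\lim_{i\to\infty}a_n(i)x_i=0\ \forall n\in\mathbb{N}\}$, a Fréchet space with the seminorms $p_n(x)=\sup_{i}a_n(i)|x_i|$. It is called a $G_1$-space (smooth sequence space of finite type) if (G1-1) $0<a_n(i+1)\le a_n(i)$ for all $n,i\in\mathbb{N}$, and (G1-2) for all $n$ there exist $m>n$ and $C>0$ such that $a_n(i)\le C\,a_m(i)^2$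 for all $i\in\mathbb{N}$. The Cesàro operator is $\mathsf{C}x=\left(\frac1i\sum_{j=1}^i x_j\right)_{i\in\mathbb{N}}$; it maps $\lambda_0(A)$ continuously into itself when (G1-1) holds. For a Fréchet space $X$, $\mathcal{L}(X)$ is the space of continuous linear operators on $X$. $T\in\mathcal{L}(X)$ is power bounded if $(T^k)_{k=1}^\infty$ is an equicontinuous subset of $\mathcal{L}(X)$. The Cesàro means of $T$ are $T_{[k]}=\frac1k\sum_{j=1}^kT^j$, $k\in\mathbb{N}$; $T$ is uniformly mean ergodic if $(T_{[k]})_k$ converges in $\mathcal{L}(X)$ for the topology of uniform convergence on bounded subsets of $X$. *)

(* Defs.v *)
From HB Require Import structures.
From mathcomp Require Import all_boot all_order all_algebra.
From mathcomp Require Import all_classical all_reals interval_inference.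
From mathcomp Require Import topology normedtype sequences convex.
From mathcomp Require Export complex.

Set Implicit Arguments.
Unset Strict Implicit.
Unset Printing Implicit Defensive.

Import Order.TTheory GRing.Theory Num.Theory.
Import numFieldNormedType.Exports.
Import ComplexField.Normc.

Local Open Scope classical_set_scope.
Local Open Scope ring_scope.
Local Open Scope complex_scope.

(** Convention: all index sets {1, 2, 3, ...} are shifted to [nat]; the
    mathematical entry $x_i$ is [x i.-1], and $a_n(i)$ is [A n.-1 i.-1]. *)

Section Operators.
Context (K : numFieldType) (X : tvsType K).
Implicit Types (B S U V : set X) (T : X -> X).

(** For [K = R[i]], [0 < s] and [s < t] force [s] and [t] to be real. *)
Definition tvs_bounded B := forall U, nbhs (0 : X) U ->
  exists2 s : K, 0 < s & forall t, s < t -> B `<=` [set t *: u | u in U].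

Definition continuous_linear T := linear T /\ continuous T.

(** The value at [k = 0] is the zero operator; it plays no role in the limit. *)
Definition ergodic_mean T (k : nat) (x : X) : X :=
  k%:R^-1 *: \sum_(1 <= j < k.+1) iter j T x.

(** [{family tvs_bounded, _ --> _}] is convergence for the topology of uniform
    convergence on the bounded sets; the limit is required to lie in L(X). *)
Definition uniformly_mean_ergodic T := exists2 P : X -> X,
  continuous_linear P & {family tvs_bounded, ergodic_mean T @ \oo --> P}.

Definition ker_op T : set X := [set x | T x = 0].

Definition id_minus T (x : X) : X := x - T x.

Definition lspan S : set X := [set x | exists (n : nat) (c : 'I_n -> K)
  (v : 'I_n -> X), (forall i, S (v i)) /\ x = \sum_(i < n) c i *: v i].

Definition is_direct_sum U V :=
  (forall x, exists u v, [/\ U u, V v & x = u + v]) /\ U `&` V = [set 0].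

End Operators.

(** [equicontinuous] asks for a pointed uniform codomain. *)
Definition power_bounded (X : puniformType) (T : X -> X) :=
  equicontinuous [set k | (0 < k)%N] (fun k : nat => iter k T).

Record koethe_matrix (R : realType) := KoetheMatrix {
  koethe_coef :> nat -> nat -> R ;
  koethe_ge0 : forall n i, 0 <= koethe_coef n i ;
  koethe_leS : forall n i, koethe_coef n i <= koethe_coef n.+1 i ;
  koethe_gt0 : forall i, exists n, 0 < koethe_coef n i }.

Definition G1_1 (R : realType) (A : koethe_matrix R) :=
  forall n i, 0 < A n i.+1 /\ A n i.+1 <= A n i.

Definition G1_2 (R : realType) (A : koethe_matrix R) :=
  forall n, exists m, (n < m)%N /\
    exists2 C : R, 0 < C & forall i, A n i <= C * A m i ^+ 2.

Definition G1_space (R : realType) (A : koethe_matrix R) := G1_1 A /\ G1_2 A.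

Section KoetheEchelon.
Context (R : realType) (A : koethe_matrix R).
Local Notation C := R[i].

(** Complex topologies are carried by the alias [C^o] of [C]. *)
Definition is_lambda0 (x : nat -> C) :=
  forall n, (fun i => (A n i)%:C * x i : C^o) @ \oo --> (0 : C^o).

Definition lambda0_pred : {pred nat -> C} := mem [set x | is_lambda0 x].

Lemma is_lambda0P (x : nat -> C) : is_lambda0 x <->
  forall n, (fun i => A n i * normc (x i)) @ \oo --> (0 : R).
Proof.
split=> h n; have {}h := h n; apply/cvgrPdist_lt.
  move=> e e0; move/cvgrPdist_lt : h => /(_ e%:C).
  rewrite ltcR => /(_ e0); apply: filterS => i.
  rewrite !sub0r !normrN normrM ger0_norm ?ler0c ?koethe_ge0//.
  rewrite -[`|x i|]/((normc (x i))%:C) -rmorphM/= ltcR.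
  rewrite ger0_norm// mulr_ge0 ?koethe_ge0//.
  by case: (x i) => a b; exact: sqrtr_ge0.
move=> e e0; move/cvgrPdist_lt : h => /(_ (complex.Re e)).
move: e0; rewrite ltcE/= => /andP[/eqP ie0 re0] /(_ re0).
apply: filterS => i.
rewrite !sub0r !normrN ger0_norm; last first.
  rewrite mulr_ge0 ?koethe_ge0//.
  by case: (x i) => a b; exact: sqrtr_ge0.
rewrite normrM ger0_norm ?ler0c ?koethe_ge0//.
rewrite -[`|x i|]/((normc (x i))%:C) -rmorphM/= => h.
by case: e ie0 re0 h => a b /= -> _ h; rewrite ltcE/= eqxx.
Qed.

Lemma lambda0_submod : submod_closed lambda0_pred.
Proof.
split=> [|c x y]; rewrite ?inE/=.
  move=> n; rewrite (_ : (fun _ => _) = cst (0 : C^o)); first exact: cvg_cst.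
  by apply/funext => i; rewrite /= mulr0.
move=> hx hy n.
rewrite (_ : (fun _ => _) =
    (fun i => c *: ((A n i)%:C * x i : C^o) + ((A n i)%:C * y i : C^o))).
  rewrite -[X in _ --> X](addr0 (0 : C^o)) -[X in _ --> X + _](scaler0 _ c).
  by apply: cvgD; [apply: cvgZr; exact: hx|exact: hy].
apply/funext => i; rewrite [(c *: x + y) i]/(c * x i + y i) mulrDr.
by rewrite [c *: _]/(c * _) mulrCA.
Qed.

HB.instance Definition _ :=
  GRing.isSubmodClosed.Build C (nat -> C) lambda0_pred lambda0_submod.

Record lambda0 := Lambda0 {
  lambda0_val :> nat -> C ; lambda0_valP : lambda0_val \in lambda0_pred }.

HB.instance Definition _ := [isSub for lambda0_val].
HB.instance Definition _ := [Choice of lambda0 by <:].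
HB.instance Definition _ := [SubChoice_isSubLmodule of lambda0 by <:].
HB.instance Definition _ := isPointed.Build lambda0 0.

Definition seminorm (n : nat) (x : lambda0) : R :=
  sup (range (fun i => A n i * normc (x i))).

Lemma normc_ge0 (z : C) : 0 <= normc z.
Proof. by case: z => a b; exact: sqrtr_ge0. Qed.

Lemma ler_normcD (y z : C) : normc (y + z) <= normc y + normc z.
Proof. by rewrite -lecR rmorphD/=; exact: (ler_normD y z). Qed.

Lemma koethe_le (n m i : nat) : (n <= m)%N -> A n i <= A m i.
Proof.
by move=> /subnK <-; elim: (m - n)%N => // k /le_trans; apply; exact: koethe_leS.
Qed.

Lemma seminorm_has_sup n (x : lambda0) :
  has_sup (range (fun i => A n i * normc (x i))).
Proof.
split; first by exists (A n 0%N * normc (x 0%N)), 0%N.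
have /set_mem/is_lambda0P/(_ n) := lambda0_valP x.
move=> /(cvgP _)/cvg_seq_bounded[M [_ hM]].
exists (M + 1) => _ [i _ <-].
by apply: le_trans (hM _ _ i I); rewrite ?ltrDl// ler_norm.
Qed.

Lemma seminorm_ub n (x : lambda0) i : A n i * normc (x i) <= seminorm n x.
Proof. by apply: ub_le_sup; [exact: (seminorm_has_sup n x).2|exists i]. Qed.

Lemma seminorm_le n (x : lambda0) (M : R) :
  (forall i, A n i * normc (x i) <= M) -> seminorm n x <= M.
Proof.
by move=> h; apply: ge_sup => [|_ [i _ <-]//]; exact: (seminorm_has_sup n x).1.
Qed.

Lemma seminorm_ge0 n x : 0 <= seminorm n x.
Proof.
by apply: le_trans (seminorm_ub n x 0); rewrite mulr_ge0 ?koethe_ge0 ?normc_ge0.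
Qed.

Lemma seminorm0 n : seminorm n 0 = 0.
Proof.
apply/eqP; rewrite eq_le seminorm_ge0 andbT.
by apply: seminorm_le => i; rewrite normc0 mulr0.
Qed.

Lemma seminormD n x y : seminorm n (x + y) <= seminorm n x + seminorm n y.
Proof.
apply: seminorm_le => i; apply: le_trans (lerD (seminorm_ub n x i) (seminorm_ub n y i)).
by rewrite -mulrDr ler_wpM2l ?koethe_ge0// ler_normcD.
Qed.

Lemma seminormZ n (c : C) x : seminorm n (c *: x) <= normc c * seminorm n x.
Proof.
apply: seminorm_le => i; rewrite [lambda0_val (c *: x) i]/(c * x i) normcM mulrCA.
by rewrite ler_wpM2l ?normc_ge0// seminorm_ub.
Qed.

Lemma normcN1 : normc (-1 : C) = 1.
Proof. by rewrite /normc /= oppr0 expr0n/= addr0 sqrrN expr1n sqrtr1. Qed.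

Lemma seminormN n x : seminorm n (- x) = seminorm n x.
Proof.
have h y : seminorm n (- y) <= seminorm n y.
  by rewrite -scaleN1r; apply: le_trans (seminormZ _ _ _) _; rewrite normcN1 mul1r.
by apply/eqP; rewrite eq_le h/= -{1}(opprK x) h.
Qed.

Lemma seminorm_mono n m x : (n <= m)%N -> seminorm n x <= seminorm m x.
Proof.
move=> nm; apply: seminorm_le => i; apply: le_trans (seminorm_ub m x i).
by rewrite ler_wpM2r ?normc_ge0// koethe_le.
Qed.

(** The uniformity generated by the seminorms; since they increase with [n], no
    finite intersections are needed. *)
Definition lambda0_ent : set_system (lambda0 * lambda0) :=
  [set E | exists n, exists2 e : R, 0 < e &
    forall x y, seminorm n (x - y) < e -> E (x, y)].

Local Lemma lambda0_ent_filter : Filter lambda0_ent.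
Proof.
split; first by exists 0%N, 1.
  move=> P Q [n [e e0 hP]] [m [d d0 hQ]]; exists (maxn n m), (Num.min e d).
    by rewrite lt_min e0.
  move=> x y; rewrite lt_min => /andP[he hd]; split.
    by apply: hP; apply: le_lt_trans he; apply: seminorm_mono; exact: leq_maxl.
  by apply: hQ; apply: le_lt_trans hd; apply: seminorm_mono; exact: leq_maxr.
by move=> P Q PQ [n [e e0 hP]]; exists n, e => // x y /hP/PQ.
Qed.

Local Lemma lambda0_ent_refl E : lambda0_ent E -> diagonal `<=` E.
Proof.
move=> [n [e e0 hE]] [x y] /= xy; rewrite /diagonal/= in xy.
by rewrite xy; apply: hE; rewrite subrr seminorm0.
Qed.

Local Lemma lambda0_ent_inv E : lambda0_ent E -> lambda0_ent E^-1%relation.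
Proof.
by move=> [n [e e0 hE]]; exists n, e => // x y h; apply: hE; rewrite -seminormN opprB.
Qed.

Local Lemma lambda0_ent_split E : lambda0_ent E ->
  exists2 D, lambda0_ent D & (D \; D)%relation `<=` E.
Proof.
move=> [n [e e0 hE]]; exists [set xy | seminorm n (xy.1 - xy.2) < e / 2].
  by exists n, (e / 2) => //; rewrite divr_gt0.
move=> [x y] /= [z xz zy]; apply: hE.
rewrite -(subrKA z x (- y)); apply: le_lt_trans (seminormD _ _ _) _.
by rewrite (splitr e) ltrD.
Qed.

HB.instance Definition _ := hasNbhs.Build lambda0 (nbhs_ lambda0_ent).
HB.instance Definition _ := Nbhs_isUniform.Build lambda0 lambda0_ent_filter
  lambda0_ent_refl lambda0_ent_inv lambda0_ent_split erefl.

Lemma lambda0_nbhsP (x : lambda0) (U : set lambda0) :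
  nbhs x U <-> exists n, exists2 e : R, 0 < e &
    forall y, seminorm n (y - x) < e -> U y.
Proof.
split=> [[E [n [e e0 hE]] EU]|[n [e e0 hU]]].
  exists n, e => // y h; apply: EU; apply/xsectionP; apply: hE.
  by rewrite -seminormN opprB.
exists [set xy | seminorm n (xy.1 - xy.2) < e]; first by exists n, e.
by move=> y /xsectionP/= h; apply: hU; rewrite -seminormN opprB.
Qed.

Lemma lambda0_add_continuous :
  continuous (fun z : lambda0 * lambda0 => z.1 + z.2).
Proof.
move=> [x y] U /lambda0_nbhsP[n [e e0 hU]].
pose B z := [set w | seminorm n (w - z) < e / 2].
exists (B x, B y) => /=.
  by split; apply/lambda0_nbhsP; exists n, (e / 2); rewrite ?divr_gt0.
move=> [u v] [/= hu hv]; apply: hU; rewrite /= opprD addrACA.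
by apply: le_lt_trans (seminormD _ _ _) _; rewrite (splitr e) ltrD.
Qed.

Lemma lambda0_scale_continuous :
  continuous (fun z : C^o * lambda0 => z.1 *: z.2).
Proof.
move=> [c x] U /lambda0_nbhsP[n [e e0 hU]].
have e2 : 0 < e / 2 by rewrite divr_gt0.
pose d := Num.min 1 (e / 2 / (seminorm n x + 1)).
have sx : 0 < seminorm n x + 1 by rewrite ltr_wpDl ?seminorm_ge0.
have cx : 0 < normc c + 1 by rewrite ltr_wpDl ?normc_ge0.
have d0 : 0 < d by rewrite lt_min ltr01 divr_gt0.
exists ([set b : C^o | normc (c - b) < d],
        [set y | seminorm n (y - x) < e / 2 / (normc c + 1)]) => /=.
  split.
    apply/nbhs_ballP; exists d%:C; first by rewrite /= ltcR.
    by move=> b; rewrite -ball_normE/= -ltcR.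
  by apply/lambda0_nbhsP; exists n, (e / 2 / (normc c + 1)); rewrite ?divr_gt0.
move=> [b y] [/= hb hy]; apply: hU => /=.
have -> : b *: y - c *: x = b *: (y - x) + (b - c) *: x.
  by rewrite scalerBr scalerBl addrA subrK.
apply: le_lt_trans (seminormD _ _ _) _; rewrite (splitr e).
have hbc : normc (b - c) < d.
  by rewrite -[normc _]mul1r -normcN1 -normcM mulN1r opprB.
move: hbc; rewrite /d lt_min => /andP[hb1 hb2].
have hbn : normc b <= normc c + 1.
  by rewrite -{1}(subrK c b) addrC; apply: le_trans (ler_normcD _ _) _; rewrite lerD2l ltW.
apply: ltr_leD.
  apply: le_lt_trans (seminormZ _ _ _) _.
  apply: (@le_lt_trans _ _ ((normc c + 1) * seminorm n (y - x))).
    by rewrite ler_wpM2r ?seminorm_ge0.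
  by rewrite mulrC -ltr_pdivlMr.
apply: le_trans (seminormZ _ _ _) _.
apply: (@le_trans _ _ (normc (b - c) * (seminorm n x + 1))).
  by rewrite ler_wpM2l ?normc_ge0// lerDl.
by rewrite -ler_pdivlMr// ltW.
Qed.

Lemma lambda0_locally_convex : exists2 B : set_system lambda0,
  (forall b, b \in B -> convex_set b) & basis B.
Proof.
exists [set b | exists n x, exists2 e : R, 0 < e &
    b = [set y | seminorm n (y - x) < e]].
  move=> b /set_mem[n [x [e e0 ->]]].
  apply/convex_setW => y z /set_mem/= hy /set_mem/= hz l l0 l1; apply/mem_set.
  rewrite /= [conv l y z]/(l%:num *: y + (1 - l%:num) *: z).
  rewrite (_ : _ - x = l%:num *: (y - x) + (1 - l%:num) *: (z - x)); last first.
    rewrite !scalerBr addrACA -opprD -scalerDl [l%:num + _]addrC.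
    by rewrite subrK scale1r addrC.
  have [r re] : exists r : R, l%:num = r%:C.
    have := ltW l0; rewrite lecE/=; case: (l%:num) => r s /= /andP[/eqP -> _].
    by exists r.
  move: l0 l1; rewrite re -(rmorph1 (real_complex R)) -rmorphB/=.
  rewrite -(rmorph0 (real_complex R)) !ltcR => l0; rewrite -subr_gt0 => l1.
  apply: le_lt_trans (seminormD _ _ _) _.
  have h t : 0 < t -> normc t%:C = t.
    by move=> t0; rewrite /normc/= expr0n/= addr0 sqrtr_sqr gtr0_norm.
  apply: (@le_lt_trans _ _ (r * seminorm n (y - x) + (1 - r) * seminorm n (z - x))).
    by apply: lerD; apply: le_trans (seminormZ _ _ _) _; rewrite h.
  have -> : e = r * e + (1 - r) * e by rewrite -mulrDl addrC subrK mul1r.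
  by apply: ltrD; rewrite ltr_pM2l.
split.
  move=> _ [n [x [e e0 ->]]]; rewrite openE => y /= hy.
  apply/lambda0_nbhsP; exists n, (e - seminorm n (y - x)); rewrite ?subr_gt0//.
  move=> z hz; rewrite /= -(subrKA y z (- x)).
  by apply: le_lt_trans (seminormD _ _ _) _; rewrite -ltrBrDr.
move=> x U /lambda0_nbhsP[n [e e0 hU]].
exists [set y | seminorm n (y - x) < e]; last by move=> y /hU.
by split; [exists n, x, e|rewrite /= subrr seminorm0].
Qed.

HB.instance Definition _ := PreTopologicalNmodule_isTopologicalNmodule.Build
  lambda0 lambda0_add_continuous.
HB.instance Definition _ := TopologicalNmodule_isTopologicalLmodule.Build
  C lambda0 lambda0_scale_continuous.
HB.instance Definition _ :=
  Uniform_isTvs.Build C lambda0 lambda0_locally_convex.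

Lemma koethe_G1_1_le (hA : G1_1 A) n i j : (i <= j)%N -> A n j <= A n i.
Proof.
move=> /subnK <-; elim: (j - i)%N => // k; apply: le_trans.
exact: (hA n (k + i)%N).2.
Qed.

Lemma normc_sum (u : nat -> C) k :
  normc (\sum_(0 <= j < k) u j) <= \sum_(0 <= j < k) normc (u j).
Proof.
elim: k => [|k IH]; first by rewrite !big_geq// normc0.
by rewrite !big_nat_recr//=; apply: le_trans (ler_normcD _ _) _; rewrite lerD2r.
Qed.

Lemma normc_nat k : normc (k%:R : C) = k%:R.
Proof.
rewrite -(rmorph_nat (real_complex R)) /normc/= expr0n/= addr0 sqrtr_sqr.
by rewrite ger0_norm.
Qed.

Lemma cesaro_bound (hA : G1_1 A) n (x : nat -> C) i :
  A n i * normc (arithmetic_mean x i) <=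
  arithmetic_mean (fun j => A n j * normc (x j)) i.
Proof.
rewrite /arithmetic_mean/= normcM normcV normc_nat mulrCA ler_wpM2l//.
rewrite /series/=; apply: le_trans (ler_wpM2l (koethe_ge0 A n i) (normc_sum _ _)) _.
rewrite mulr_sumr; apply: ler_sum_nat => j /andP[_ ji].
by rewrite ler_wpM2r ?normc_ge0// koethe_G1_1_le.
Qed.

Lemma cesaro_in_lambda0 (hA : G1_1 A) (x : lambda0) :
  arithmetic_mean x \in lambda0_pred.
Proof.
apply/mem_set/is_lambda0P => n.
have /set_mem/is_lambda0P/(_ n)/cesaro h := lambda0_valP x.
apply: (squeeze_cvgr _ (cvg_cst _) h); apply: nearW => i.
by rewrite mulr_ge0 ?koethe_ge0 ?normc_ge0//= cesaro_bound.
Qed.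

(** [arithmetic_mean x i] is [(x 0 + ... + x i) / i.+1]. *)
Definition cesaro_op (hA : G1_1 A) (x : lambda0) : lambda0 :=
  Lambda0 (cesaro_in_lambda0 hA x).

Lemma cesaro_op_continuous_linear (hA : G1_1 A) :
  continuous_linear (cesaro_op hA).
Proof.
have lin : linear (cesaro_op hA).
  move=> c x y; apply/val_inj/funext => i.
  rewrite [RHS]/(c * arithmetic_mean x i + arithmetic_mean y i).
  rewrite [LHS]/= /arithmetic_mean /series/=.
  rewrite [X in _ = X + _]mulrCA -mulrDr; congr (_ * _).
  by rewrite mulr_sumr -big_split.
split=> // x U /lambda0_nbhsP[n [e e0 hU]].
apply/lambda0_nbhsP; exists n, e => // y hy; apply: hU.
apply: le_lt_trans hy.
rewrite (_ : _ - _ = cesaro_op hA (y - x)); last first.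
  by rewrite (addrC y) -(scaleN1r x) lin scaleN1r addrC.
apply: seminorm_le => i; apply: le_trans (cesaro_bound hA _ _ _) _.
rewrite /arithmetic_mean/= ler_pdivrMl// /series/=.
apply: le_trans (_ : \sum_(0 <= j < i.+1) seminorm n (y - x) <= _).
  by apply: ler_sum_nat => j _; exact: (seminorm_ub n (y - x) j).
by rewrite big_const_nat subn0 iter_addr_0 mulr_natl.
Qed.

Lemma unit_vec_in_lambda0 (k : nat) : (fun i => (i == k)%:R) \in lambda0_pred.
Proof.
apply/mem_set => n; apply: (cvg_near_cst); exists k.+1 => // i /= ki.
by rewrite gtn_eqF// mulr0.
Qed.

Definition unit_vec (k : nat) : lambda0 := Lambda0 (unit_vec_in_lambda0 k).

Lemma ones_in_lambda0 (h0 : forall n, A n @ \oo --> (0 : R)) :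
  (fun=> 1) \in lambda0_pred.
Proof.
apply/mem_set/is_lambda0P => n.
rewrite (_ : (fun _ => _) = A n)//.
by apply/funext => i; rewrite normc1 mulr1.
Qed.

Definition ones (h0 : forall n, A n @ \oo --> (0 : R)) : lambda0 :=
  Lambda0 (ones_in_lambda0 h0).

End KoetheEchelon.

Arguments unit_vec {R} A k.

(* Main.v *)
(** The means of [C] converge to [P x = x 0 *: 1]. Since [C] fixes the constants
    and does not increase any seminorm, it suffices to study [C^k] on sequences
    vanishing at index [0]. There the first [N.+1] entries contract
    geometrically, with ratio [N / N.+1], while (G1-2) and [A m i --> 0] give
    [A n i <= c * A m i ^+ 2 <= e * A m i] for large [i], so that the tail of
    [C^k x] is small in [p_n] by [p_m (C^k x) <= p_m x]. Hence
    [p_n (C^k x) <= e * p_m x] for [k] large, uniformly in [x], and the mean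
    inherits this estimate. As [x - C^k x] lies in the range of [I - C], the
    same estimate shows that this range is dense in [{x | x 0 = 0}]. *)

Require Import Defs.
From HB Require Import structures.
From mathcomp Require Import all_boot all_order all_algebra.
From mathcomp Require Import all_classical all_reals topology normedtype.
From mathcomp Require Import sequences complex ring.

Set Implicit Arguments.
Unset Strict Implicit.
Unset Printing Implicit Defensive.

Import Order.TTheory GRing.Theory Num.Theory.
Import numFieldNormedType.Exports.

Local Open Scope classical_set_scope.
Local Open Scope ring_scope.

Import ComplexField.Normc.

(** At most [K] terms are estimated by [S], costing [K * S <= e * k * S]; the remaining ones cost
    [e * S] each. Each group contributes one [e]. *)
Lemma mean_le_of_tail (R : realFieldType) (u : nat -> R) (S e : R)
    (K k : nat) :
  0 <= e -> (forall j, u j <= S) -> (forall j, (K <= j)%N -> u j <= e * S) ->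
  0 <= S -> (0 < k)%N -> K%:R <= e * k%:R ->
  k%:R^-1 * \sum_(1 <= j < k.+1) u j <= (e + e) * S.
Proof.
move=> e0 uS ueS S0 k0 Kk; rewrite ler_pdivrMl ?ltr0n//.
(* The [minn] makes the bound valid for [l] below [K] as well, so that induction on [l] applies. *)
suff h l : \sum_(1 <= j < l.+1) u j <= (minn l K)%:R * S + l%:R * (e * S).
  apply: le_trans (h k) _.
  rewrite !mulrDl mulrDr lerD2r mulrA (mulrC k%:R) ler_wpM2r//.
  by apply: le_trans Kk; rewrite ler_nat geq_minr.
elim: l => [|l IH]; first by rewrite big_geq// mul0r addr0 mulr_ge0.
rewrite big_nat_recr//=; apply: le_trans (lerD IH (lexx _)) _.
have eS : 0 <= e * S by rewrite mulr_ge0.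
rewrite -addrA -[l.+1]addn1 (natrD _ l) mulrDl mul1r.
have [Kl|lK] := leqP K l.
  rewrite !(minn_idPr _) ?addn1 ?(leq_trans Kl)//.
  by rewrite lerD2l lerD2l ueS// (leq_trans Kl).
rewrite !(minn_idPl _) ?addn1 ?(ltnW lK)// -(natr1 l) mulrDl mul1r.
rewrite -addrA lerD2l [leRHS]addrCA lerD2l.
by apply: le_trans (uS _) _; rewrite lerDl.
Qed.

(** * The topology of the echelon space in terms of its seminorms *)

Section Lambda0.
Context (R : realType) (A : koethe_matrix R).
Implicit Types (x y : lambda0 A) (n m i k : nat).

Lemma seminorm_closureP (S : set (lambda0 A)) x : closure S x <->
  forall n e, 0 < e -> exists2 y, S y & seminorm n (y - x) < e.
Proof.
split=> [cSx n e e0|h U /lambda0_nbhsP[n [e e0 hU]]].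
  have [|y [Sy hy]] := cSx [set y | seminorm n (y - x) < e]; last by exists y.
  by apply/lambda0_nbhsP; exists n, e.
by have [y Sy /hU Uy] := h n e e0; exists y.
Qed.

Lemma lambda0_fun_continuous (T : lambda0 A -> lambda0 A) :
  (forall n, exists2 M : R, 0 < M &
    forall x y, seminorm n (T y - T x) <= M * seminorm n (y - x)) ->
  continuous T.
Proof.
move=> hT x U /lambda0_nbhsP[n [e e0 hU]]; have [M M0 hM] := hT n.
apply/lambda0_nbhsP; exists n, (e / M); first by rewrite divr_gt0.
move=> y; rewrite ltr_pdivlMr// mulrC => hy; apply: hU.
exact: le_lt_trans hy.
Qed.

(** A bounded set lies in a multiple of the unit ball of [seminorm m], so the estimate becomes
    uniform on it. The multiple depends on [m], hence [m] must be chosen before [e]. *)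
Lemma lambda0_family_cvg (F : nat -> lambda0 A -> lambda0 A)
    (G : lambda0 A -> lambda0 A) :
  (forall n, exists m, forall e : R, 0 < e -> \forall k \near \oo, forall x,
    seminorm n (F k x - G x) <= e * seminorm m x) ->
  {family @tvs_bounded _ (lambda0 A), F @ \oo --> G}.
Proof.
move=> hF; apply/fam_cvgP => B bB P /uniform_nbhs[E [[n [e e0 hE]] EP]].
have [m hm] := hF n.
have [|s s0 hs] := bB [set x | seminorm m x < 1].
  by apply/lambda0_nbhsP; exists m, 1 => // y; rewrite subr0.
(* Absorption is only given for scalars strictly above [s], hence [s + 1]. *)
have {}hs x : B x -> seminorm m x <= normc (s + 1).
  move=> /(hs (s + 1)); rewrite ltrDl ltr01 => /(_ isT)[u /= hu <-].
  apply: le_trans (seminormZ _ _ _) _.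
  by rewrite -[leRHS]mulr1 ler_wpM2l ?normc_ge0// ltW.
set M := normc (s + 1) in hs.
have M0 : 0 < M + 1 by rewrite ltr_wpDl ?normc_ge0.
apply: filterS (hm (e / (M + 1)) (divr_gt0 e0 M0)) => k hk.
apply: EP => x Bx; apply: hE; rewrite -seminormN opprB.
apply: le_lt_trans (hk x) _; rewrite mulrAC ltr_pdivrMr// ltr_pM2l//.
by apply: le_lt_trans (hs _ Bx) _; rewrite ltrDl.
Qed.

Lemma lambda0_ext x y : (forall i, x i = y i) -> x = y.
Proof. by move=> xy; apply/val_inj/funext. Qed.

Lemma lambda0_addE x y i : (x + y) i = x i + y i.
Proof. by []. Qed.

Lemma lambda0_subE x y i : (x - y) i = x i - y i.
Proof. by []. Qed.

Lemma lambda0_scaleE (c : R[i]) x i : (c *: x) i = c * x i.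
Proof. by []. Qed.

Lemma unit_vecE k i : unit_vec A k i = (i == k)%:R.
Proof. by []. Qed.

Lemma onesE (hA0 : forall n, A n @ \oo --> (0 : R)) i : ones hA0 i = 1.
Proof. by []. Qed.

Lemma lambda0_sumE (I : Type) (r : seq I) (Q : pred I) (v : I -> lambda0 A) i :
  (\sum_(k <- r | Q k) v k) i = \sum_(k <- r | Q k) v k i.
Proof. exact: (big_morph (fun x => lambda0_val x i)). Qed.

(** For [k > 0], [x] is the mean of [k] copies of itself, so the triangle inequality applies
    termwise. *)
Lemma seminorm_mean n (v : nat -> lambda0 A) x k : (0 < k)%N ->
  seminorm n (k%:R^-1 *: (\sum_(1 <= j < k.+1) v j) - x) <=
  k%:R^-1 * \sum_(1 <= j < k.+1) seminorm n (v j - x).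
Proof.
move=> k0; have kn0 : k%:R != 0 :> R[i] by rewrite pnatr_eq0 -lt0n.
have -> : k%:R^-1 *: (\sum_(1 <= j < k.+1) v j) - x =
    k%:R^-1 *: \sum_(1 <= j < k.+1) (v j - x).
  rewrite big_split/= scalerDr; congr (_ + _).
  rewrite sumr_const_nat subn1 -[_ *+ _.-1]scaler_nat scalerA.
  by rewrite mulVf ?scale1r.
apply: le_trans (seminormZ _ _ _) _; rewrite normcV normc_nat.
rewrite ler_wpM2l ?invr_ge0//.
elim/big_ind2 : _ => [|a b c d ab cd|//]; first by rewrite seminorm0.
by apply: le_trans (seminormD _ _ _) _; exact: lerD.
Qed.

End Lambda0.

(** * Iterates of the Cesàro operator *)

Section Cesaro.
Context (R : realType) (A : koethe_matrix R) (hA : G1_1 A).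
Local Notation C := (cesaro_op hA).
Implicit Types (x y : lambda0 A) (n m i k : nat).

HB.instance Definition _ := GRing.isLinear.Build R[i] (lambda0 A) (lambda0 A)
  *:%R C (cesaro_op_continuous_linear hA).1.

Lemma G1_1_gt0 n i : 0 < A n i.
Proof. by apply: (lt_le_trans (hA n i).1); exact: (hA n i).2. Qed.

Lemma cesaro_opE x i : C x i = i.+1%:R^-1 * \sum_(0 <= j < i.+1) x j.
Proof. by []. Qed.

Lemma iter_cesaroB k x y : iter k C (x - y) = iter k C x - iter k C y.
Proof. by elim: k => //= k ->; rewrite raddfB. Qed.

(** As the weights decrease in [i], a weighted entry of [C x] is at most the mean of the weighted
    entries of [x]. *)
Lemma seminorm_cesaro n x : seminorm n (C x) <= seminorm n x.
Proof.
apply: seminorm_le => i; apply: le_trans (cesaro_bound hA _ _ _) _.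
rewrite /arithmetic_mean/= ler_pdivrMl// /series/=.
apply: le_trans (_ : \sum_(0 <= j < i.+1) seminorm n x <= _).
  by apply: ler_sum_nat => j _; exact: seminorm_ub.
by rewrite sumr_const_nat subn0 mulr_natl.
Qed.

Lemma seminorm_iter_cesaro n x k : seminorm n (iter k C x) <= seminorm n x.
Proof. by elim: k => //= k; exact/le_trans/seminorm_cesaro. Qed.

Lemma iter_cesaro0 x k : iter k C x 0%N = x 0%N.
Proof.
by elim: k => // k IH; rewrite iterS cesaro_opE big_nat1 invr1 mul1r.
Qed.

Lemma cesaro_power_bounded : power_bounded C.
Proof.
move=> x E [n [e e0 hE]]; apply/lambda0_nbhsP; exists n, e => // y yx k _.
apply: hE; rewrite -iter_cesaroB.
by apply: le_lt_trans (seminorm_iter_cesaro _ _ _) _; rewrite -seminormN opprB.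
Qed.

(* On sequences vanishing at the first index, row [i] of the Cesaro matrix has
   [l^1] norm [i / i.+1], whence the contraction factor. *)
Lemma iter_cesaro_contract x N (M : R) : x 0%N = 0 ->
  (forall i, (i <= N)%N -> normc (x i) <= M) ->
  forall k i, (i <= N)%N ->
  normc (iter k C x i) <= (N%:R / N.+1%:R) ^+ k * M.
Proof.
move=> x0 xM; elim=> [i iN|k IH i iN]; first by rewrite expr0 mul1r xM.
set M' := _ ^+ k * M in IH.
have M'0 : 0 <= M' by apply: le_trans (IH 0%N _); rewrite ?normc_ge0.
rewrite exprS -mulrA -/M' iterS cesaro_opE normcM normcV normc_nat.
rewrite big_ltn// iter_cesaro0 x0 add0r.
apply: le_trans (_ : i%:R / i.+1%:R * M' <= _).
  rewrite mulrAC mulrC ler_wpM2r ?invr_ge0// mulr_natl.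
  rewrite big_add1; apply: le_trans (normc_sum _ _) _.
  rewrite -[i in leRHS]subn0 -sumr_const_nat; apply: ler_sum_nat => j /andP[_ ji].
  by apply: IH; exact: leq_trans iN.
(* The ratio [i / i.+1] increases with [i], so [i <= N] bounds it by [N / N.+1]. *)
rewrite ler_wpM2r// ler_pdivrMr// mulrAC ler_pdivlMr//.
by rewrite -!natrM ler_nat !mulnS (mulnC N) leq_add2r.
Qed.

Lemma iter_cesaro_vanishing (hA2 : G1_2 A)
    (hA0 : forall n, A n @ \oo --> (0 : R)) n :
  exists2 m, (n <= m)%N & forall e : R, 0 < e -> \forall k \near \oo,
    forall x, x 0%N = 0 -> seminorm n (iter k C x) <= e * seminorm m x.
Proof.
(* Here [m] comes from (G1-2) alone; only the cut [N] and the threshold for [k] depend on [e]. *)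
have [m [nm [c c0 hc]]] := hA2 n; exists m => [|e e0]; first exact: ltnW.
have [N _ hN] : \forall i \near \oo, A m i <= e / c.
  have /cvgrPdist_le/(_ _ (divr_gt0 e0 c0)) := hA0 m.
  by apply: filterS => i; rewrite sub0r normrN; apply: le_trans; exact: ler_norm.
set r : R := N%:R / N.+1%:R.
have r1 : `|r| < 1.
  by rewrite ger0_norm ?divr_ge0// ltr_pdivrMr// mul1r ltr_nat.
(* For indices up to [N], entries of [x] are at most [seminorm m x / A m N] and weights at most
   [A n 0]. The power of [r] has to absorb the resulting factor [A n 0 / A m N]. *)
have d0 : 0 < A m N / A n 0%N by rewrite divr_gt0 ?G1_1_gt0.
have /cvgrPdist_le/(_ _ (mulr_gt0 e0 d0)) := cvg_expr r1.
apply: filterS => k hk x x0; apply: seminorm_le => i.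
have [Ni|iN] := leqP N i.
  apply: le_trans (ler_wpM2r (normc_ge0 _) (hc i)) _.
  rewrite expr2 -!mulrA; apply: le_trans (_ : c * (e / c * seminorm m x) <= _).
    rewrite ler_wpM2l ?(ltW c0)// ler_pM ?koethe_ge0 ?hN//.
      by rewrite mulr_ge0 ?koethe_ge0 ?normc_ge0.
    exact: le_trans (seminorm_ub _ _ _) (seminorm_iter_cesaro _ _ _).
  by rewrite mulrA mulrCA mulfV ?gt_eqF// mulr1.
have xM j : (j <= N)%N -> normc (x j) <= seminorm m x / A m N.
  move=> jN; rewrite ler_pdivlMr ?G1_1_gt0// mulrC.
  apply: le_trans (seminorm_ub m x j).
  by rewrite ler_wpM2r ?normc_ge0// koethe_G1_1_le.
have hi := iter_cesaro_contract x0 xM k (ltnW iN).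
apply: le_trans (ler_pM (koethe_ge0 _ _ _) (normc_ge0 _)
  (koethe_G1_1_le hA n (leq0n i)) hi) _.
set S := seminorm m x.
have -> : e * S = A n 0%N * (e * (A m N / A n 0%N) * (S / A m N)).
  by field; rewrite !gt_eqF ?G1_1_gt0.
rewrite ler_wpM2l ?koethe_ge0// ler_wpM2r ?divr_ge0 ?seminorm_ge0 ?koethe_ge0//.
by apply: le_trans hk; rewrite sub0r normrN ler_norm.
Qed.

(** * Fixed points of the operator, and the sequences vanishing at index [0] *)

Lemma cesaro_fix_const x : C x = x -> forall i, x i = x 0%N.
Proof.
move=> Cx; elim=> // i <-.
(* Comparing these sums at [i] and [i.+1] gives [i.+1 * x i + x i.+1 = i.+2 * x i.+1], so
   consecutive entries agree. *)
have sumE k : \sum_(0 <= j < k.+1) x j = k.+1%:R * x k.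
  by rewrite -[in RHS]Cx cesaro_opE mulVKf// pnatr_eq0.
have := sumE i.+1; rewrite big_nat_recr//= sumE -[i.+2%:R]natr1 mulrDl mul1r.
by move=> /addIr /mulfI -> //; rewrite pnatr_eq0.
Qed.

Lemma range_id_minus_iter_cesaro k x :
  range (id_minus C) (x - iter k C x).
Proof.
(* Applying [I - C] to this sum telescopes. *)
exists (\sum_(0 <= j < k) iter j C x) => //.
rewrite /id_minus raddf_sum -sumrB -[RHS]opprB.
rewrite -[_ - x](telescope_sumr (fun j => iter j C x) (leq0n k)) -sumrN.
by apply: eq_bigr => j _; rewrite opprB.
Qed.

(** Since [A 0 0 > 0], evaluation at index [0] is controlled by [seminorm 0]. *)
Lemma closure_vanishing0_sub : closure [set x : lambda0 A | x 0%N = 0]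
  `<=` [set x : lambda0 A | x 0%N = 0].
Proof.
move=> x /seminorm_closureP clx; apply: eq0_normc; apply/eqP.
rewrite eq_le normc_ge0 andbT; apply/ler_addgt0Pl => e e0; rewrite addr0.
have [y y0 hy] := clx 0%N (A 0%N 0%N * e) (mulr_gt0 (G1_1_gt0 _ _) e0).
have := le_trans (seminorm_ub 0%N (y - x) 0%N) (ltW hy).
rewrite ler_pM2l ?G1_1_gt0// lambda0_subE y0 sub0r.
by rewrite -mulN1r normcM normcN1 mul1r.
Qed.

Lemma vanishing0_closure_lspan : [set x : lambda0 A | x 0%N = 0] =
  closure (lspan (unit_vec A @` [set k | (1 <= k)%N])).
Proof.
apply/seteqP; split=> [x /= x0|].
  apply/seminorm_closureP => n e e0.
  have /set_mem/is_lambda0P/(_ n)/cvgrPdist_lt := lambda0_valP x.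
  move=> /(_ (e / 2)); rewrite divr_gt0// => /(_ isT)[N _ hN].
  (* The truncation of [x] to the indices [1] to [N]; the error consists of later entries, whose
     weighted moduli tend to zero. *)
  exists (\sum_(k < N) x k.+1 *: unit_vec A k.+1).
    exists N, (fun k => x k.+1), (fun k => unit_vec A k.+1); split=> // k.
    by exists k.+1.
  (* Entrywise bounds pass to the supremum only as weak inequalities; [e / 2] keeps the final one
     strict. *)
  apply: (@le_lt_trans _ _ (e / 2)); last by rewrite ltr_pdivrMr// ltr_pMr// ltr1n.
  apply: seminorm_le => -[|i].
    rewrite lambda0_subE x0 subr0 lambda0_sumE.
    rewrite big1 ?normc0 ?mulr0 ?divr_ge0 ?(ltW e0)// => k _.
    by rewrite lambda0_scaleE unit_vecE mulr0.
  rewrite lambda0_subE lambda0_sumE.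
  under eq_bigr => k _ do rewrite lambda0_scaleE unit_vecE eqSS.
  have [iN|Ni] := ltnP i N.
    rewrite (bigD1 (Ordinal iN))//= eqxx mulr1 big1 ?addr0 => [|k ki].
      by rewrite subrr normc0 mulr0 divr_ge0// ltW.
    by move: ki; rewrite -val_eqE/= eq_sym => /negbTE->; rewrite mulr0.
  rewrite big1 ?sub0r => [|k _]; last by rewrite gtn_eqF ?mulr0// (leq_trans _ Ni).
  have := hN i.+1 (leq_trans Ni (leqnSn _)); rewrite sub0r normrN => /ltW.
  by rewrite -mulN1r normcM normcN1 mul1r; apply: le_trans; exact: ler_norm.
apply: subset_trans closure_vanishing0_sub; apply: closureS.
move=> _ [N [c [v [hv ->]]]] /=.
elim/big_ind : _ => [//|a b a0 b0|i _].
  by rewrite lambda0_addE a0 b0 addr0.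
by have [k k0 <-] := hv i; rewrite lambda0_scaleE unit_vecE ltn_eqF// mulr0.
Qed.

(** * The limit projection, mean ergodicity and the closure of the range *)

Section LimitZero.
Context (hA2 : G1_2 A) (hA0 : forall n, A n @ \oo --> (0 : R)).
Local Notation one := (ones hA0).

(** The projection onto the constants along the sequences vanishing at index [0]. *)
Definition eval0_ones x : lambda0 A := x 0%N *: one.
Local Notation P := eval0_ones.

Lemma cesaro_ones c : C (c *: one) = c *: one.
Proof.
rewrite linearZ; congr (_ *: _); apply: lambda0_ext => i.
by rewrite [LHS]cesaro_opE sumr_const_nat subn0 mulVf// pnatr_eq0.
Qed.

Lemma sub_eval0_ones x : (x - P x) 0%N = 0.
Proof. by rewrite lambda0_subE lambda0_scaleE mulr1 subrr. Qed.

Lemma iter_cesaro_sub_eval0_ones k x : iter k C (x - P x) = iter k C x - P x.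
Proof. by rewrite iter_cesaroB [iter k C (P x)](iter_fix _ (cesaro_ones _)). Qed.

Lemma eval0_ones_bounded n :
  exists2 D : R, 0 < D & forall x, seminorm n (P x) <= D * seminorm n x.
Proof.
(* From [A n 0 * normc (x 0) <= seminorm n x]; the added [1] makes the constant visibly positive. *)
exists ((seminorm n one + 1) / A n 0%N) => [|x].
  by rewrite divr_gt0 ?G1_1_gt0// ltr_wpDl ?seminorm_ge0.
apply: le_trans (seminormZ _ _ _) _.
rewrite mulrAC ler_pdivlMr ?G1_1_gt0// mulrC mulrA [leRHS]mulrC.
by rewrite ler_pM ?mulr_ge0 ?koethe_ge0 ?normc_ge0 ?seminorm_ge0 ?seminorm_ub ?lerDl.
Qed.

Lemma eval0_ones_continuous_linear : continuous_linear P.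
Proof.
have linP : linear P by move=> c x y; rewrite /P scalerA -scalerDl.
split=> //; apply: lambda0_fun_continuous => n.
have [D D0 hD] := eval0_ones_bounded n; exists D => // x y.
by rewrite /P -scalerBl; exact: (hD (y - x)).
Qed.

Lemma iter_cesaro_cvg n : exists2 m, (n <= m)%N & forall e : R, 0 < e ->
  \forall k \near \oo, forall x,
    seminorm n (iter k C x - P x) <= e * seminorm m (x - P x).
Proof.
have [m nm hm] := iter_cesaro_vanishing hA2 hA0 n; exists m => // e /hm.
apply: filterS => k hk x; have := hk _ (sub_eval0_ones x).
by rewrite iter_cesaro_sub_eval0_ones.
Qed.

Lemma cesaro_uniformly_mean_ergodic : uniformly_mean_ergodic C.
Proof.
exists P; first exact: eval0_ones_continuous_linear.
apply: lambda0_family_cvg => n.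
have [m nm hm] := iter_cesaro_cvg n; have [D D0 hD] := eval0_ones_bounded m.
exists m => e e0.
have D1 : 0 < 1 + D by rewrite addr_gt0.
(* The [2] offsets the doubling in [mean_le_of_tail], and [1 + D] the passage from [x - P x] to [x]
   in [seminorm m]. *)
pose d := e / 2 / (1 + D).
have d0 : 0 < d by rewrite !divr_gt0.
have [K _ hK] := hm _ d0.
have [L _ hL] : \forall k \near \oo, K%:R / d <= k%:R :> R.
  exact: nbhs_infty_ger.
(* Beyond [L] the first [K] terms are negligible in the mean; the [1] excludes the degenerate mean
   at [k = 0]. *)
exists (maxn 1 L) => // k; rewrite /= geq_max => /andP[k0 Lk] x.
apply: le_trans (seminorm_mean _ _ _ k0) _.
apply: le_trans (mean_le_of_tail (ltW d0) _ _ (seminorm_ge0 m (x - P x)) k0 _) _.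
- move=> j; apply: le_trans (seminorm_mono _ nm).
  by rewrite -iter_cesaro_sub_eval0_ones; exact: seminorm_iter_cesaro.
- exact: (fun j Kj => hK j Kj x).
- by rewrite mulrC -ler_pdivrMr// hL.
have -> : e * seminorm m x = (d + d) * ((1 + D) * seminorm m x).
  by rewrite /d; field; rewrite gt_eqF.
rewrite ler_pM2l ?addr_gt0// mulrDl mul1r.
by apply: le_trans (seminormD _ _ _) _; rewrite seminormN lerD2l hD.
Qed.

Lemma closure_range_id_minus_cesaro :
  closure (range (id_minus C)) = [set x : lambda0 A | x 0%N = 0].
Proof.
apply/seteqP; split=> [|x x0].
  apply: subset_trans closure_vanishing0_sub; apply: closureS => _ [x _ <-].
  (* [C] preserves the entry at index [0], which therefore cancels in [x - C x]. *)
  by rewrite /mkset /id_minus lambda0_subE (iter_cesaro0 x 1) subrr.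
apply/seminorm_closureP => n e e0.
have [m nm hm] := iter_cesaro_vanishing hA2 hA0 n.
have S0 : 0 < seminorm m x + 1 by rewrite ltr_wpDl ?seminorm_ge0.
have [K _ /(_ K (leqnn _) x x0) hK] := hm _ (divr_gt0 e0 S0).
exists (x - iter K C x); first exact: range_id_minus_iter_cesaro.
rewrite addrAC subrr add0r seminormN; apply: le_lt_trans hK _.
by rewrite mulrAC ltr_pdivrMr// ltr_pM2l// ltrDl.
Qed.

End LimitZero.

End Cesaro.

Theorem proposition10 (R : realType) (A : koethe_matrix R)
    (hA : G1_space A)
    (hA0 : forall n, A n @ \oo --> (0 : R)) :
  let C := cesaro_op (proj1 hA) in
  [/\ power_bounded C,
      uniformly_mean_ergodic C,
      is_direct_sum (ker_op (id_minus C)) (closure (range (id_minus C))),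
      ker_op (id_minus C) = lspan [set ones hA0]
    & closure (range (id_minus C)) = [set x : lambda0 A | x 0%N = 0] /\
      [set x : lambda0 A | x 0%N = 0] =
        closure (lspan (unit_vec A @` [set k | (1 <= k)%N]))].
Proof.
move=> C; have hA2 := proj2 hA.
have kerE : ker_op (id_minus C) = [set c *: ones hA0 | c in [set: R[i]]].
  apply/seteqP; split=> [x /eqP|_ [c _ <-]]; last first.
    by rewrite /ker_op/= /id_minus /C cesaro_ones subrr.
  rewrite subr_eq0 => /eqP/esym Cx; exists (x 0%N) => //.
  apply: lambda0_ext => i; rewrite lambda0_scaleE onesE mulr1.
  exact/esym/(cesaro_fix_const Cx).
have rangeE := closure_range_id_minus_cesaro (proj1 hA) hA2.
split.
- exact: cesaro_power_bounded.
- exact: cesaro_uniformly_mean_ergodic hA2 hA0.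
- rewrite rangeE// kerE; split=> [x|].
    exists (eval0_ones hA0 x), (x - eval0_ones hA0 x); split.
    + by exists (x 0%N).
    + exact: sub_eval0_ones.
    + by rewrite addrC subrK.
  apply/seteqP; split=> [x [[c _ <-]]|x ->]; last by split=> //; exists 0; rewrite ?scale0r.
  (* A constant sequence vanishing at index [0] is zero. *)
  by rewrite /mkset lambda0_scaleE onesE mulr1 => ->; rewrite scale0r.
- rewrite kerE; apply/seteqP; split=> [_ [c _ <-]|_ [N [c [v [hv ->]]]]].
    exists 1%N, (fun=> c), (fun=> ones hA0); split=> //.
    by rewrite big_ord1.
  (* All the vectors [v i] equal [ones hA0], so their coefficients add up. *)
  exists (\sum_(i < N) c i) => //; rewrite scaler_suml.
  by apply: eq_bigr => i _; rewrite (hv i).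
- by split; [exact: rangeE|exact: vanishing0_closure_lspan (proj1 hA)].
Qed.
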